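(* There exists an absolute constant $K>0$ such that the following holds. Suppose $\Gamma$ is a group acting isometrically on the spaces $X$ and $X_\ast$ such that: (i) $X_\ast$ is a $\delta$-hyperbolic metric space and the action of $\Gamma$ on $X_\ast$ is non-elementary; and (ii) $X$ is a (possibly asymmetric) geodesic metric space and the action of $\Gamma$ on $X$ is $D$-cobounded. If $L>6D$, then $$\operatorname{Dil}(X_\ast,X)\le \left(\sup_{0<\ell_X[g]\le L}\frac{\ell_{X_\ast}[g]}{\ell_X[g]}\right)\cdot\left(\frac{L-2D}{L-6D}\right)+\frac{2K\delta}{L-6D},$$ where the supremum is over conjugacy classes $[g]$ of $\Gamma$ with $0<\ell_X[g]\le L$.
   Context: Here $\delta,D\ge 0$. A possibly asymmetric metric $d$ on $X$ satisfies all axioms of a metric (nonnegativity, $d(x,x)=0$, point separation, triangle inequality) except possibly symmetry. Geodesic is meant in the usual sense: for any $x,y\in X$ there is a path $\gamma:[0,d(x,y)]\to X$ from $x$ to $y$ with $d(\gamma(s),\gamma(t))=t-s$ for all $s\le t$. An action of $\Gamma$ on $(X,d_X)$ is isometric if $d_X(gx,gy)=d_X(x,y)$ for all $g\in\Gamma$ and $x,y\in X$. It is $D$-cobounded if for any $x,x'\in X$ there is $g\in\Gamma$ with $\max\{d_X(gx,x'),d_X(x',gx)\}\le D$. The Gromov product is $(x|y)_z=\frac12(d(x,z)+d(z,y)-d(x,y))$, and a metric $d$ is $\delta$-hyperbolic if $(x|y)_z\ge\min\{(x|w)_z,(y|w)_z\}-\delta$ for all $x,y,z,w$. The metric on $X_\ast$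 is symmetric; the action on $X_\ast$ is not required to be proper, cobounded, or acylindrical. An isometric action on a hyperbolic space is non-elementary (in the usual sense) if it contains two loxodromic elements with disjoint fixed point sets in the Gromov boundary. $\mathbf{conj}$ is the set of conjugacy classes of $\Gamma$. The stable translation length is $\ell_X[g]=\lim_{k\to\infty}\frac1k d_X(x,g^kx)$ (independent of $x\in X$), and similarly for $X_\ast$. The dilation is $$\operatorname{Dil}(X_\ast,X)=\inf\{\eta>0:\ \ell_{X_\ast}[g]\le\eta\,\ell_X[g]\text{ for all }[g]\in\mathbf{conj}\}\in[0,+\infty],$$ equal to $+\infty$ if no such $\eta$ exists.
   Formalization: The formal theorem adds the hypothesis that $\ell_X[g]=0$ implies $\ell_{X_\ast}[g]=0$; without it the dilation is infinite while the right-hand side can be finite, so the claim as stated fails. The supremum over an empty set of classes is taken to be 0. *)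

(* Defs.v *)
From HB Require Import structures.
From mathcomp Require Import all_boot all_order all_algebra.
From mathcomp Require Import all_classical all_reals all_analysis.

Set Implicit Arguments.
Unset Strict Implicit.
Unset Printing Implicit Defensive.

Import Order.TTheory GRing.Theory Num.Theory.
Import numFieldNormedType.Exports.

Local Open Scope classical_set_scope.
Local Open Scope ring_scope.

Record asymmetric_metric (R : realType) (X : Type) (d : X -> X -> R) : Prop := {
  asym_ge0 : forall x y, 0 <= d x y ;
  asym_refl : forall x, d x x = 0 ;
  asym_sep : forall x y, d x y = 0 -> x = y ;
  asym_triangle : forall x y z, d x z <= d x y + d y z
}.

(* The path is a total function R -> X; only its values on [0, d x y] matter. *)
Definition geodesic (R : realType) (X : Type) (d : X -> X -> R) : Prop :=
  forall x y, exists gam : R -> X,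
    [/\ gam 0 = x, gam (d x y) = y &
        forall s t, 0 <= s -> s <= t -> t <= d x y ->
          d (gam s) (gam t) = t - s].

Record group_action (G : groupType) (X : Type) (act : G -> X -> X) : Prop := {
  action1 : forall x, act 1%g x = x ;
  actionM : forall g h x, act (g * h)%g x = act g (act h x)
}.

Record isometric_action (R : realType) (X : Type) (d : X -> X -> R)
    (G : groupType) (act : G -> X -> X) : Prop := {
  isometric_is_action : group_action act ;
  action_isometry : forall g x y, d (act g x) (act g y) = d x y
}.

Definition cobounded (R : realType) (X : Type) (d : X -> X -> R)
    (G : groupType) (act : G -> X -> X) (D : R) : Prop :=
  forall x x', exists g, Num.max (d (act g x) x') (d x' (act g x)) <= D.

Definition gromov_product (R : realType) (X : Type) (d : X -> X -> R)
    (x y z : X) : R := (d x z + d z y - d x y) / 2.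

Definition hyperbolic (R : realType) (X : Type) (d : X -> X -> R)
    (delta : R) : Prop :=
  forall x y z w,
    Num.min (gromov_product d x w z) (gromov_product d y w z) - delta
      <= gromov_product d x y z.

(* (s_i | t_j)_o --> +oo as i, j --> oo. This does not depend on o. *)
Definition fellow_sequences (R : realType) (X : Type) (d : X -> X -> R)
    (s t : nat -> X) : Prop :=
  forall o, (fun ij : nat * nat => gromov_product d (s ij.1) (t ij.2) o)
              @ filter_prod \oo \oo --> +oo.

Definition converges_at_infinity (R : realType) (X : Type) (d : X -> X -> R)
    (s : nat -> X) : Prop := fellow_sequences d s s.

(* Points at infinity are the equivalence classes, as sets of sequences. *)
Definition gromov_boundary (R : realType) (X : Type) (d : X -> X -> R)
    : set (set (nat -> X)) :=
  [set [set t | converges_at_infinity d t /\ fellow_sequences d s t]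
     | s in converges_at_infinity d].

Definition boundary_action (G : groupType) (X : Type) (act : G -> X -> X)
    (g : G) (xi : set (nat -> X)) : set (nat -> X) :=
  [set (fun n => act g (s n)) | s in xi].

Definition boundary_fixed_points (R : realType) (X : Type) (d : X -> X -> R)
    (G : groupType) (act : G -> X -> X) (g : G) : set (set (nat -> X)) :=
  [set xi | gromov_boundary d xi /\ boundary_action act g xi = xi].

Definition gpow (G : groupType) (g : G) (m : int) : G :=
  match m with
  | Posz n => (g ^+ n)%g
  | Negz n => (g ^- n.+1)%g
  end.

(* Some (equivalently, any) orbit map m |-> g^m x is a quasi-isometric
   embedding of Z. *)
Definition loxodromic (R : realType) (X : Type) (d : X -> X -> R)
    (G : groupType) (act : G -> X -> X) (g : G) : Prop :=
  exists (x : X) (a b : R), [/\ 1 <= a, 0 <= b &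
    forall m n : int,
      a^-1 * `|m - n|%:~R - b <= d (act (gpow g m) x) (act (gpow g n) x) /\
      d (act (gpow g m) x) (act (gpow g n) x) <= a * `|m - n|%:~R + b].

Definition non_elementary (R : realType) (X : Type) (d : X -> X -> R)
    (G : groupType) (act : G -> X -> X) : Prop :=
  exists g h : G, [/\ loxodromic d act g, loxodromic d act h &
    boundary_fixed_points d act g `&` boundary_fixed_points d act h = set0].

Definition conj_class (G : groupType) (g : G) : set G :=
  [set (g ^ h)%g | h in [set: G]].

Definition conj_classes (G : groupType) : set (set G) := range (@conj_class G).

Definition stable_length (R : realType) (X : Type) (d : X -> X -> R)
    (G : groupType) (act : G -> X -> X) (x : X) (g : G) : R :=
  limn (fun k => d x (act (g ^+ k)%g x) / k%:R).

(* For isometric actions the stable length depends neither on the basepoint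
   nor on the representative of the conjugacy class c, so any choice of a
   representative will do; the default value 1 is irrelevant, as conjugacy
   classes are nonempty. *)
Definition class_length (R : realType) (X : Type) (d : X -> X -> R)
    (G : groupType) (act : G -> X -> X) (x : X) (c : set G) : R :=
  stable_length d act x (xget 1%g c).

(* Both functions below take two length functions on conjugacy classes, lstar
   (length on the target space) and l. *)
Definition dilation (R : realType) (G : groupType) (lstar l : set G -> R)
    : \bar R :=
  ereal_inf [set eta%:E | eta in [set eta : R |
    0 < eta /\ forall c, conj_classes c -> lstar c <= eta * l c]].

(* The supremum is taken in [0, +oo], so that it is 0 (not -oo, as ereal_sup
   alone would give) when no class satisfies 0 < l c <= L. *)
Definition sup_length_ratio (R : realType) (G : groupType)
    (lstar l : set G -> R) (L : R) : \bar R :=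
  maxe 0%E (ereal_sup [set (lstar c / l c)%:E | c in [set c |
    conj_classes c /\ (0 < l c /\ l c <= L)]]).

(* If some class has l c = 0 < lstar c, then the dilation is +oo, a fact which
   sup_length_ratio, being blind to classes with l c = 0, need not detect. *)
Definition null_classes_null (R : realType) (G : groupType)
    (lstar l : set G -> R) : Prop :=
  forall c, conj_classes c -> l c = 0 -> lstar c = 0.

(* Main.v *)
Require Import Defs.
From HB Require Import structures.
From mathcomp Require Import all_boot all_order all_algebra.
From mathcomp Require Import all_classical all_reals all_analysis.
From mathcomp Require Import lra.

Set Implicit Arguments.
Unset Strict Implicit.
Unset Printing Implicit Defensive.

Import Order.TTheory GRing.Theory Num.Theory.
Import numFieldNormedType.Exports.

Local Open Scope classical_set_scope.
Local Open Scope ring_scope.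

(** The stable length of g on the hyperbolic space is controlled by writing a
    large power of g as a product of elements that move the base point of X by
    at most L / 2, and by showing that on the hyperbolic space such a product
    grows no faster than the stable lengths of its factors and of their
    pairwise products allow.

    Subdivide a geodesic of X from x0 to g^n x0 into steps of length
    r = L / 2 - 2 D and replace the subdivision points by nearby points of the
    orbit of x0 ([geodesic_word]).  This gives g^n = s_0 ... s_m with
    d(x0, s_i x0) <= L / 2 and m <= d(x0, g^n x0) / r.  The s_i and the
    s_i s_j have stable length at most L on X, hence, with M the supremum of
    the ratios, stable lengths at most M L / 2 and M L on the hyperbolic space.

    The heart is [joint_displacement]: if finitely many isometries s_i of a
    delta-hyperbolic space satisfy l(s_i) < C and l(s_i s_j) < 2 C, with
    C > 36 delta, then some point is moved by at most C + 120 delta by all of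
    them.  On a tree (delta = 0) this is the Helly property: each set
    T_i = {p : d(p, s_i p) <= C} is a subtree, T_i and T_j meet because
    otherwise s_i s_j would translate by more than 2 C, and the projection of a
    base point o to the farthest of the T_i lies in all of them.  That
    projection is the point p of the segment [o, s_i o] at distance
    (d(o, s_i o) - C) / 2 from o, where s_i moves o the most.
    [disp_le_of_products] redoes the tree argument for the point p with additive
    errors, starting from the inequality d(x, s^2 x) <= d(x, s x) + l(s) + 2 delta
    ([disp_sqr_le]).  As the space need not be geodesic, p is found in an
    approximate injective hull, which is 3 delta-hyperbolic
    ([hull_hyperbolic]) and carries an action extending the given one.

    The displacement of p is subadditive along words, so that
    n l(g) <= (d(x0, g^n x0) / r + 1) (C + 120 delta) with C close to
    M L / 2 + 36 delta.  Dividing by n, the length on the hyperbolic space is at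
    most (M L + 312 delta) / (L - 4 D) times the length on X; this is a little
    better than the bound to be proved, with K = 156. *)

(** * Linear growth and subadditive sequences *)

(** The device by which limits of u n / n are compared below: it is insensitive
    to a change of base point, which only alters B. *)
Definition growth_le (R : realType) (u : nat -> R) (c : R) : Prop :=
  exists B, forall n, u n <= c * n%:R + B.

(** The archimedean property, in the form in which additive constants are lost. *)
Lemma slope_le (R : realType) (a b B : R) :
  (forall n, a * n%:R <= b * n%:R + B) -> a <= b.
Proof.
move=> h; rewrite leNgt; apply/negP => ba.
have ab0 : 0 < a - b by rewrite subr_gt0.
have /archi_boundP : 0 <= `|B| / (a - b) by rewrite divr_ge0 // ltW.
move: (Num.bound _) => n; rewrite ltr_pdivrMr// mulrC mulrBl => hB.
have := h n; have := ler_norm B; lra.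
Qed.

Lemma growth_slope_le (R : realType) (a b : R) (u : nat -> R) :
  (forall n, a * n%:R <= u n) -> growth_le u b -> a <= b.
Proof. by move=> h [B hB]; apply: (@slope_le _ _ _ B) => n; exact: le_trans (hB n). Qed.

Section Fekete.
Variables (R : realType) (u : nat -> R).
Hypothesis u_ge0 : forall n, 0 <= u n.
Hypothesis u0 : u 0%N = 0.
Hypothesis uD : forall m n, u (m + n)%N <= u m + u n.

Lemma subadditive_mul q m : u (q * m) <= q%:R * u m.
Proof.
elim: q => [|q IH]; first by rewrite mul0n u0 mul0r.
rewrite mulSn -natr1 mulrDl mul1r addrC.
by apply: le_trans (uD _ _) _; rewrite lerD2l.
Qed.

(** Divide n by m with remainder; the remainder costs at most m u(1). *)
Lemma subadditive_growth m : (0 < m)%N -> growth_le u (u m / m%:R).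
Proof.
move=> m0; exists (m%:R * u 1%N) => n.
have mR : 0 < m%:R :> R by rewrite ltr0n.
rewrite {1}(divn_eq n m); apply: le_trans (uD _ _) _; apply: lerD.
  apply: le_trans (subadditive_mul _ _) _.
  rewrite mulrC -mulrA ler_wpM2l// ler_pdivlMl// mulrC -natrM ler_nat.
  exact: leq_divM.
rewrite -{1}[(n %% m)%N]muln1; apply: le_trans (subadditive_mul _ _) _.
by rewrite ler_wpM2r// ler_nat ltnW// ltn_pmod.
Qed.

Let rates : set R := [set u n.+1 / n.+1%:R | n in [set: nat]].

Let rates_inf : has_inf rates.
Proof.
split; first by exists (u 1%N / 1%:R), 0.
by exists 0 => _ [n _ <-]; rewrite divr_ge0.
Qed.

(** Fekete's lemma: each rate u(m) / m bounds all the later ones up to an error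
    that tends to 0, so the rates converge to their infimum. *)
Lemma fekete : (fun k => u k / k%:R) @ \oo --> inf rates.
Proof.
apply/cvgrPdist_le => e e0.
have e2 : 0 < e / 2 by rewrite divr_gt0.
have [_ [m _ <-] hm] := inf_adherent e2 rates_inf.
have [B hB] := subadditive_growth (ltn0Sn m).
near=> k.
have k0 : (0 < k)%N by near: k; exact: nbhs_infty_gt.
have kR : 0 < k%:R :> R by rewrite ltr0n.
have hk : inf rates <= u k / k%:R.
  by apply: ge_inf; [case: rates_inf|exists k.-1 => //; rewrite prednK].
rewrite distrC ger0_norm ?subr_ge0// lerBlDl.
rewrite ler_pdivrMr//; apply: le_trans (hB k) _.
have : B <= e / 2 * k%:R.
  rewrite -ler_pdivrMl ?divr_gt0//; near: k; exact: nbhs_infty_ger.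
set r := u m.+1 / m.+1%:R in hm *.
have : r * k%:R <= (inf rates + e / 2) * k%:R by rewrite ler_wpM2r// ltW.
rewrite !mulrDl; lra.
Unshelve. all: end_near. Qed.

Definition mean_limit := limn (fun k => u k / k%:R).

Lemma mean_limitE : mean_limit = inf rates.
Proof. by apply/cvg_lim => //; exact: fekete. Qed.

Lemma mean_limit_le m : (0 < m)%N -> mean_limit <= u m / m%:R.
Proof.
move=> m0; rewrite mean_limitE.
by apply: ge_inf; [case: rates_inf|exists m.-1 => //; rewrite prednK].
Qed.

Lemma mean_limit_ge0 : 0 <= mean_limit.
Proof.
rewrite mean_limitE; apply: lb_le_inf; first by case: rates_inf.
by move=> _ [n _ <-]; rewrite divr_ge0.
Qed.

Lemma mean_limit_lb n : mean_limit * n%:R <= u n.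
Proof.
case: n => [|n]; first by rewrite mulr0.
by rewrite -ler_pdivlMr ?ltr0n// mean_limit_le.
Qed.

Lemma growth_of_mean_limit c : mean_limit < c -> growth_le u c.
Proof.
rewrite mean_limitE -subr_gt0 => hc.
have [_ [m _ <-] hm] := inf_adherent hc rates_inf.
have [B hB] := subadditive_growth (ltn0Sn m).
exists B => n; apply: le_trans (hB n) _; rewrite lerD2r ler_wpM2r//.
by rewrite addrC subrK in hm; exact: ltW.
Qed.

Lemma mean_limit_of_growth c : growth_le u c -> mean_limit <= c.
Proof. exact/growth_slope_le/mean_limit_lb. Qed.
End Fekete.

(** * Displacements *)

Section Displacement.
Variables (R : realType) (X : Type) (d : X -> X -> R).
Variables (G : groupType) (act : G -> X -> X).

Definition disp (x : X) (g : G) : R := d x (act g x).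

Definition orbit_growth_le (x : X) (g : G) (c : R) : Prop :=
  growth_le (fun n => disp x (g ^+ n)%g) c.

Hypothesis dtri : forall x y z, d x z <= d x y + d y z.
Hypothesis act_iso : isometric_action d act.

Let act1 : forall x, act 1%g x = x.
Proof. exact: action1 (isometric_is_action act_iso). Qed.
Let actM g h x : act (g * h)%g x = act g (act h x).
Proof. exact: actionM (isometric_is_action act_iso) _ _ _. Qed.
Let iso g x y : d (act g x) (act g y) = d x y.
Proof. exact: action_isometry act_iso _ _ _. Qed.

Lemma dispM x g h : disp x (g * h)%g <= disp x g + disp x h.
Proof. by rewrite /disp actM -(iso g x (act h x)); exact: dtri. Qed.

Lemma disp_shift x y g : disp y g <= d y x + d x y + disp x g.
Proof.
rewrite /disp; have := dtri y x (act g y); have := dtri x (act g x) (act g y).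
rewrite iso; lra.
Qed.

Lemma orbit_growth_shift x y g c : orbit_growth_le x g c -> orbit_growth_le y g c.
Proof.
case=> B hB; exists (d y x + d x y + B) => n.
apply: le_trans (disp_shift x _ _) _; have := hB n; lra.
Qed.

Lemma disp_conj x g h : disp x (g ^ h)%g = disp (act h x) g.
Proof. by rewrite /disp conjgE !actM -[RHS](iso h^-1%g) -!actM mulVg act1 -mulgA. Qed.

(** Conjugating g by h moves the base point to h x. *)
Lemma orbit_growth_conj x g h c :
  orbit_growth_le x (g ^ h)%g c <-> orbit_growth_le x g c.
Proof.
have E : (fun n => disp x ((g ^ h) ^+ n)%g) = (fun n => disp (act h x) (g ^+ n)%g).
  by apply/funext => n; rewrite -conjXg disp_conj.
split.
  by rewrite /orbit_growth_le E => /(orbit_growth_shift x).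
by move=> /(orbit_growth_shift (act h x)); rewrite /orbit_growth_le E.
Qed.

End Displacement.

(** * Isometries of hyperbolic spaces *)

Record pseudometric (R : realType) (X : Type) (d : X -> X -> R) : Prop := {
  pseudo_refl : forall x, d x x = 0 ;
  pseudo_sym : forall x y, d x y = d y x ;
  pseudo_triangle : forall x y z, d x z <= d x y + d y z
}.

Section HyperbolicActions.
Variables (R : realType) (X : Type) (d : X -> X -> R) (e : R).
Variables (G : groupType) (act : G -> X -> X).
Hypothesis dP : pseudometric d.
Hypothesis hyp : hyperbolic d e.
Hypothesis act_iso : isometric_action d act.

Let d0 x : d x x = 0. Proof. exact: pseudo_refl dP _. Qed.
Let dC x y : d x y = d y x. Proof. exact: pseudo_sym dP _ _. Qed.
Let dtri x y z : d x z <= d x y + d y z.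
Proof. exact: pseudo_triangle dP _ _ _. Qed.
Let act1 : forall x, act 1%g x = x.
Proof. exact: action1 (isometric_is_action act_iso). Qed.
Let actM g h x : act (g * h)%g x = act g (act h x).
Proof. exact: actionM (isometric_is_action act_iso) _ _ _. Qed.
Let iso g x y : d (act g x) (act g y) = d x y.
Proof. exact: action_isometry act_iso _ _ _. Qed.

Lemma pseudometric_ge0 x y : 0 <= d x y.
Proof. have := dtri x y x; rewrite d0 (dC y x); lra. Qed.

Lemma hyperbolic_cases x y z w :
  gromov_product d x w z - e <= gromov_product d x y z \/
  gromov_product d y w z - e <= gromov_product d x y z.
Proof.
have := hyp x y z w; case: (leP (gromov_product d x w z)) => _; by [left|right].
Qed.

(** The three sums of opposite sides of a quadrangle: the largest two differ by
    at most 2 e. *)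
Lemma four_point x y z w :
  d x y + d z w <= d x z + d y w + 2 * e \/
  d x y + d z w <= d x w + d y z + 2 * e.
Proof.
have := hyperbolic_cases x y z w; rewrite /gromov_product.
by rewrite (dC z y) (dC z w) => -[] ?; [right|left]; lra.
Qed.

(** If g^2 moved x by more than this, then by the four-point inequality each step
    of the orbit x, g x, g^2 x, ... would go further from x by a fixed amount
    larger than c, so that the orbit would escape faster than c. *)
Lemma disp_sqr_le x g c : 0 <= e -> orbit_growth_le d act x g c ->
  disp d act x (g * g)%g <= disp d act x g + c + 2 * e.
Proof.
move=> e0 gc; set a := fun n => disp d act x (g ^+ n)%g.
have a0 n : 0 <= a n by exact: pseudometric_ge0.
have c0 : 0 <= c.
  case: gc => B hB; apply: (@slope_le _ _ _ B) => n.
  by rewrite mul0r; exact: le_trans (a0 n) (hB n).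
rewrite leNgt; apply/negP => big.
set t := disp d act x (g * g)%g - disp d act x g - 2 * e.
have ct : c < t by rewrite /t; lra.
have a1E : a 1%N = disp d act x g by rewrite /a expg1.
have a2E : a 2%N = disp d act x (g * g)%g by rewrite /a expg2.
have a2 : a 2%N <= a 1%N + a 1%N by rewrite a1E a2E; exact: dispM dtri act_iso _ _ _.
have incr n : t <= a n.+1 - a n.
  elim: n => [|n IH].
    have -> : a 0%N = 0 by rewrite /a expg0 /disp act1.
    by rewrite subr0 /t -a1E -a2E; lra.
  (* The other case of the inequality would make the orbit come closer to x. *)
  have := four_point x (act (g * g)%g x) (act g x) (act (g ^+ n.+2)%g x).
  have -> : d (act g x) (act (g ^+ n.+2)%g x) = a n.+1 by rewrite expgS actM iso.
  have -> : d (act (g * g)%g x) (act (g ^+ n.+2)%g x) = a n.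
    by rewrite !expgS !actM !iso.
  have -> : d (act (g * g)%g x) (act g x) = a 1%N by rewrite actM iso dC a1E.
  rewrite -[d x (act (g ^+ _)%g x)]/(a n.+2) -[d x (act g x)]/(disp d act x g).
  rewrite -[d x (act (g * g)%g x)]/(disp d act x (g * g)%g) a1E -/(a n.+2).
  rewrite /t in IH ct *; case => ?; lra.
have lin n : t * n%:R <= a n.
  elim: n => [|n IH]; first by rewrite mulr0.
  rewrite -natr1 mulrDr mulr1; have := incr n; lra.
have := growth_slope_le lin gc; lra.
Qed.

(** The tree picture: u is the distance from x to the set moved by at most C by s,
    and p, on [x, s x], is the projection of x to that set.  If t moved p by much
    more than C, then t p and t^-1 p would both lie on the side of x, because t
    does not move x more than s does; whereas s p and s^-1 p lie on other sides.
    Hence s^-1 p, p, t p are nearly aligned, s t moves p by about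
    d(p, s p) + d(p, t p), and this product would translate by more than 2 C.
    The condition C > 12 e gives s p room to be told apart from p. *)
Lemma disp_le_of_products p x s t u C : 0 <= e -> 12 * e < C ->
  d x p <= u -> d p (act s x) <= u + C -> d x (act s x) = 2 * u + C ->
  disp d act x t <= 2 * u + C ->
  orbit_growth_le d act p s C -> orbit_growth_le d act p t C ->
  orbit_growth_le d act p (s * t)%g (2 * C) ->
  disp d act p t <= C + 40 * e.
Proof.
move=> e0 eC xp psx xsx xtx gs gt gst.
have sK y : act s (act s^-1%g y) = y by rewrite -actM mulgV act1.
have tK y : act t (act t^-1%g y) = y by rewrite -actM mulgV act1.
rewrite leNgt; apply/negP => far.
set m := disp d act p t in far.
have ptp : d p (act t p) = m by [].
(* First locate s p and s^-1 p: p is moved by s by about C, away from x. *)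
have xssx : d x (act s (act s x)) <= 2 * u + C + C + 2 * e.
  have := disp_sqr_le e0 (orbit_growth_shift dtri act_iso x gs).
  by rewrite /disp actM xsx.
have spsx : d (act s p) (act s x) <= u by rewrite iso dC.
have spssx : d (act s p) (act s (act s x)) <= u + C by rewrite iso.
have sxssx : d (act s x) (act s (act s x)) = 2 * u + C by rewrite iso.
have spx : d (act s p) x <= u + C + 4 * e.
  case: (four_point (act s p) x (act s x) (act s (act s x))) => ?; lra.
have psp_le : d p (act s p) <= C + 6 * e.
  have := four_point p (act s p) x (act s x); rewrite (dC p x) => -[] ?; lra.
have xsp : u + C <= d x (act s p) by have := dtri x (act s p) (act s x); lra.
have psp_ge : C <= d p (act s p) by have := dtri x p (act s p); lra.
have psx_ge : u + C <= d p (act s x) by have := dtri x p (act s x); lra.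
(* Now t: both t p and t^-1 p are seen from p in the direction of x. *)
have ptt : d p (act t (act t p)) <= m + C + 2 * e.
  by have := disp_sqr_le e0 gt; rewrite /disp actM.
have xtp_ptx : d x (act t p) + d p (act t x) <= 2 * u + C + m + 2 * e.
  have := four_point x (act t p) p (act t x); rewrite (dC (act t p) p) iso (dC p x) ptp.
  have : d x (act t x) <= 2 * u + C by [].
  move=> ? -[] ?; lra.
(* inverse translates *)
have E1 : d x (act t^-1%g p) = d p (act t x) by rewrite -(iso t) tK dC.
have E2 : d p (act t^-1%g p) = m by rewrite -(iso t) tK dC ptp.
have E3 : d (act t p) (act t^-1%g p) = d p (act t (act t p)).
  by rewrite -(iso t) tK dC.
have E4 : d x (act s^-1%g p) = d p (act s x) by rewrite -(iso s) sK dC.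
have E5 : d p (act s^-1%g p) = d p (act s p) by rewrite -(iso s) sK dC.
have S1 := dC (act s^-1%g p) p; have S2 := dC (act s p) p.
have S3 := dC (act t p) p; have S4 := dC (act t^-1%g p) p.
have S5 := dC (act t p) (act t^-1%g p).
have both : m - C - 6 * e <= 2 * (u + m - d x (act t p)) /\
            m - C - 6 * e <= 2 * (u + m - d p (act t x)).
  have := hyperbolic_cases x (act t p) p (act t^-1%g p).
  have := hyperbolic_cases x (act t^-1%g p) p (act t p).
  rewrite /gromov_product => -[] ? [] ?; lra.
(* So the Gromov products at p of t^(+-1) p with s^(-+1) p are at most 4 e. *)
have prod1 : d p (act s p) + m - 8 * e <= d (act s^-1%g p) (act t p).
  have := hyperbolic_cases x (act s^-1%g p) p (act t p).
  rewrite /gromov_product => -[] ?; lra.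
have prod2 : d p (act s p) + m - 8 * e <= d (act t^-1%g p) (act s p).
  have := hyperbolic_cases x (act s p) p (act t^-1%g p).
  have S6 := dC (act s p) (act t^-1%g p).
  rewrite /gromov_product => -[] ?; lra.
(* The slow growth of s t then forces t^-1 p and s p into one direction. *)
have AE : d p (act s (act t p)) = d (act s^-1%g p) (act t p) by rewrite -[RHS](iso s) sK.
pose A := d p (act s (act t p)).
have E6 : d p (act (s * t)^-1%g p) = A.
  by rewrite -(iso (s * t)%g) -actM mulgV act1 dC actM.
have ptpt : d (act (s * t)^-1%g p) (act s (act t p)) <= A + 2 * C + 2 * e.
  have := disp_sqr_le e0 gst; rewrite /disp -[X in _ -> X <= _](iso (s * t)%g).
  by rewrite -[act (s * t)%g (act (s * t)^-1%g p)]actM mulgV act1 !actM.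
have E7 : d (act t^-1%g p) (act (s * t)^-1%g p) = d p (act s p).
  rewrite -(iso (s * t)%g) -[act (s * t)%g (act (s * t)^-1%g p)]actM.
  by rewrite mulgV act1 actM tK dC.
have E8 : d (act s p) (act s (act t p)) = m by rewrite iso.
have := hyperbolic_cases (act t^-1%g p) (act s p) p (act s (act t p)).
have := hyperbolic_cases (act t^-1%g p) (act s (act t p)) p (act (s * t)^-1%g p).
have S7 := dC (act s (act t p)) p; have S8 := dC (act (s * t)^-1%g p) p.
have S9 := dC (act s (act t p)) (act (s * t)^-1%g p).
have S10 := dC (act s p) (act s (act t p)).
rewrite /A in E6 ptpt; rewrite /gromov_product => -[] ? [] ?; lra.
Qed.
End HyperbolicActions.

(** * An approximate injective hull *)

Section Hull.
Variables (R : realType) (X : Type) (d : X -> X -> R) (e : R) (o : X).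
Hypothesis dP : pseudometric d.
Hypothesis hyp : hyperbolic d e.

(** A point p of a geodesic extension of X is encoded by f z = d(p, z).  The
    injective hull consists of the f with f z = sup_y (d z y - f y); here the
    upper bound is attained and the lower bound relaxed by 2 e, which lets explicit
    functions represent the points of a segment. *)
Definition tight (f : X -> R) : Prop :=
  (forall z y, d z y <= f z + f y + 2 * e) /\
  (forall z, exists y, f z + f y <= d z y).

Definition hull : Type := {f : X -> R | tight f}.

Definition sup_dist (f g : X -> R) : R := sup [set `|f z - g z| | z in [set: X]].

Definition hull_dist (f g : hull) : R := sup_dist (sval f) (sval g).

Let d0 x : d x x = 0. Proof. exact: pseudo_refl dP _. Qed.
Let dC x y : d x y = d y x. Proof. exact: pseudo_sym dP _ _. Qed.
Let dtri x y z : d x z <= d x y + d y z.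
Proof. exact: pseudo_triangle dP _ _ _. Qed.

Lemma tight_near f z : tight f -> `|f z - d o z| <= f o + 2 * e.
Proof.
case=> low up; rewrite ler_distl; apply/andP; split.
  by have := low o z; lra.
have [y hy] := up z; have := low o y; have := dtri z o y; rewrite (dC z o); lra.
Qed.

Lemma sup_dist_le f g M : (forall z, `|f z - g z| <= M) -> sup_dist f g <= M.
Proof. by move=> h; apply: ge_sup => [|_ [z _ <-]//]; exists `|f o - g o|, o. Qed.

Lemma sup_distC f g : sup_dist f g = sup_dist g f.
Proof.
by congr sup; apply/seteqP; split=> _ [z _ <-]; exists z => //; rewrite distrC.
Qed.

Lemma le_sup_dist f g z : tight f -> tight g -> `|f z - g z| <= sup_dist f g.
Proof.
move=> tf tg; apply: ub_le_sup; last by exists z.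
exists (f o + 2 * e + (g o + 2 * e)) => _ [y _ <-].
have := tight_near y tf; have := tight_near y tg; rewrite !ler_distl.
by move=> /andP[? ?] /andP[? ?]; apply/andP; split; lra.
Qed.

(** For tight functions the sup distance is, up to 2 e, the supremum of
    d z y - f z - g y; this lemma and the next are the two halves.  In this form
    the four-point inequality passes from X to the hull. *)
Lemma sup_dist_witness f g t : tight f -> tight g -> 0 < t ->
  exists z y, sup_dist f g <= d z y - f z - g y + t.
Proof.
move=> tf tg t0.
have hs : has_sup [set `|f z - g z| | z in [set: X]].
  split; first by exists `|f o - g o|, o.
  by exists (sup_dist f g) => _ [z _ <-]; exact: le_sup_dist.
have [_ [z _ <-]] := sup_adherent t0 hs; rewrite -/(sup_dist f g) => h.
have [fg|gf] := leP (f z) (g z).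
  have [y hy] := tg.2 z; exists z, y; move: h; rewrite ler0_norm ?subr_le0//.
  lra.
have [y hy] := tf.2 z; exists y, z; move: h; rewrite gtr0_norm ?subr_gt0// (dC y z); lra.
Qed.

Lemma sup_dist_lower f g z y : tight f -> tight g ->
  d z y - f z - g y - 2 * e <= sup_dist f g.
Proof.
move=> tf tg; have := le_sup_dist y tf tg; have := ler_norm (f y - g y).
have := tf.1 z y; lra.
Qed.

Lemma hull_hyperbolic : hyperbolic hull_dist (3 * e).
Proof.
move=> [x tx] [y ty] [z tz] [w tw]; rewrite /gromov_product /hull_dist /=.
apply/ler_addgt0Pr => t t0.
have t2 : 0 < t / 2 by rewrite divr_gt0.
have [a [b hab]] := sup_dist_witness tx ty t2.
have [p [q hpq]] := sup_dist_witness tz tw t2.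
have C1 : sup_dist z y = sup_dist y z by exact: sup_distC.
have C2 : sup_dist z w = sup_dist w z by exact: sup_distC.
rewrite lerBlDr ge_min; apply/orP.
have [h|h] := four_point dP hyp a b p q.
- right.
  have := sup_dist_lower a p tx tz; have := sup_dist_lower b q ty tw; lra.
- left.
  have := sup_dist_lower a q tx tw; have := sup_dist_lower b p ty tz; lra.
Qed.

Lemma hull_pseudometric : pseudometric hull_dist.
Proof.
split.
- move=> [f tf]; apply/eqP; rewrite eq_le /hull_dist /=; apply/andP; split.
    by apply: sup_dist_le => z; rewrite subrr normr0.
  by apply: le_trans (le_sup_dist o tf tf).
- by move=> f g; exact: sup_distC.
- move=> [f tf] [g tg] [h th]; apply: sup_dist_le => z.
  apply: le_trans (ler_distD (g z) _ _) _.
  by apply: lerD; apply: le_sup_dist.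
Qed.

Hypothesis e0 : 0 <= e.

Lemma tight_dist x : tight (d x).
Proof.
split=> [z y|z]; last by exists x; rewrite d0 addr0 dC.
have := dtri z x y; rewrite (dC z x); have := e0; lra.
Qed.

Definition hull_point x : hull := exist tight (d x) (tight_dist x).

Lemma hull_dist_point x y : hull_dist (hull_point x) (hull_point y) = d x y.
Proof.
apply/eqP; rewrite eq_le; apply/andP; split.
  apply: sup_dist_le => z /=; rewrite ler_distl; apply/andP; split.
    by have := dtri y x z; have := dC x y; lra.
  by have := dtri x y z; have := dC x y; lra.
have := le_sup_dist y (tight_dist x) (tight_dist y).
by rewrite d0 subr0; apply: le_trans; exact: ler_norm.
Qed.

(** The point at distance u from a on a segment [a, b] of length u + v of a tree is
    at distance max (d a z - u) (d b z - v) from z. *)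
Lemma hull_segment a b u v : 0 <= u -> 0 <= v -> u + v = d a b ->
  exists p, hull_dist (hull_point a) p <= u /\ hull_dist p (hull_point b) <= v.
Proof.
move=> u0 v0 uv; pose f z := Num.max (d a z - u) (d b z - v).
have f_ge z : d a z - u <= f z /\ d b z - v <= f z by rewrite !le_max !lexx orbT.
have tf : tight f.
  split=> [z y|z].
    have [? ?] := f_ge z; have [? ?] := f_ge y.
    have := four_point dP hyp z y a b.
    by rewrite (dC z a) (dC z b) (dC y a) (dC y b) -uv => -[] ?; lra.
  have fa : f a = u.
    by rewrite /f d0 (dC b a) -uv addrK; apply: max_r; lra.
  have fb : f b = v.
    by rewrite /f d0 -uv addrC addKr; apply: max_l; lra.
  have [h|h] := leP (d a z - u) (d b z - v).
    by exists b; rewrite fb /f (max_r h) (dC z b) subrK.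
  by exists a; rewrite fa /f (max_l (ltW h)) (dC z a) subrK.
have f_le z : f z <= d a z + u /\ f z <= d b z + v.
  have := dtri a b z; have := dtri b a z; rewrite (dC b a) => ? ?.
  by split; rewrite ge_max; apply/andP; split; lra.
exists (exist tight f tf); split; apply: sup_dist_le => z /=.
  have [? ?] := f_ge z; have [? ?] := f_le z.
  by rewrite ler_distl; apply/andP; split; lra.
have [? ?] := f_ge z; have [? ?] := f_le z.
by rewrite ler_distl; apply/andP; split; lra.
Qed.

Variables (G : groupType) (act : G -> X -> X).
Hypothesis act_iso : isometric_action d act.

Let act1 : forall x, act 1%g x = x.
Proof. exact: action1 (isometric_is_action act_iso). Qed.
Let actM g h x : act (g * h)%g x = act g (act h x).
Proof. exact: actionM (isometric_is_action act_iso) _ _ _. Qed.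
Let iso g x y : d (act g x) (act g y) = d x y.
Proof. exact: action_isometry act_iso _ _ _. Qed.
Let actK g x : act g^-1%g (act g x) = x.
Proof. by rewrite -actM mulVg act1. Qed.

Lemma tight_act g f : tight f -> tight (fun z => f (act g^-1%g z)).
Proof.
case=> low up; split=> [z y|z]; first by rewrite -(iso g^-1%g).
have [y hy] := up (act g^-1%g z).
by exists (act g y); rewrite actK -(iso g^-1%g z) actK.
Qed.

Definition hull_act (g : G) (f : hull) : hull :=
  exist tight (fun z => sval f (act g^-1%g z)) (tight_act g (svalP f)).

Lemma hull_isometric_action : isometric_action hull_dist hull_act.
Proof.
split; first split.
- move=> [f tf]; apply: eq_exist; apply/funext => z /=.
  by rewrite invg1 act1.
- move=> g h [f tf]; apply: eq_exist; apply/funext => z /=.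
  by rewrite invgM actM.
- move=> g [x tx] [y ty]; apply/eqP; rewrite eq_le; apply/andP; split.
    by apply: sup_dist_le => z; exact: (le_sup_dist (act g^-1%g z) tx ty).
  apply: sup_dist_le => z /=; rewrite -{1 2}(actK g z).
  exact: (le_sup_dist (act g z) (tight_act g tx) (tight_act g ty)).
Qed.

Lemma hull_act_point g x : hull_act g (hull_point x) = hull_point (act g x).
Proof.
apply: eq_exist; apply/funext => z /=.
by rewrite -(iso g) -actM mulgV act1.
Qed.

Lemma disp_hull_point x g :
  disp hull_dist hull_act (hull_point x) g = disp d act x g.
Proof. by rewrite /disp hull_act_point hull_dist_point. Qed.

End Hull.

(** * Finite sets of isometries with small products *)

(** The function nu is the displacement of a point p of the hull.  Only its
    subadditivity and the comparison with the displacement of o matter afterwards,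
    which keeps the hull out of the statement.  The point p is taken with respect
    to an s_i that moves o the most; if even that one moves o by at most C, then o
    itself serves. *)
Lemma joint_displacement (R : realType) (X : Type) (d : X -> X -> R) (e : R)
    (G : groupType) (act : G -> X -> X) (I : finType) (i0 : I) (s : I -> G)
    (o : X) (C : R) :
  pseudometric d -> hyperbolic d e -> isometric_action d act ->
  0 <= e -> 36 * e < C ->
  (forall i, orbit_growth_le d act o (s i) C) ->
  (forall i j, orbit_growth_le d act o (s i * s j)%g (2 * C)) ->
  exists (nu : G -> R) (B : R),
    [/\ forall g h, nu (g * h)%g <= nu g + nu h,
        forall i, nu (s i) <= C + 120 * e &
        forall g, disp d act o g <= nu g + B].
Proof.
move=> dP hyp iso e0 eC gs gss.
have [i _ imax] := @arg_maxP _ R I i0 predT (fun i => disp d act o (s i)) isT.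
have {}imax j : disp d act o (s j) <= disp d act o (s i) by exact: imax.
have [small|large] := leP (disp d act o (s i)) C.
  exists (disp d act o), 0; split=> [g h|j|g]; last by rewrite addr0.
    by apply: dispM iso _ _ _; case: dP.
  have := imax j; lra.
(* The distance from o to the set of points moved by at most C by s i. *)
pose u := (disp d act o (s i) - C) / 2.
have uE : 2 * u + C = disp d act o (s i).
  by rewrite /u mulrC divfK ?pnatr_eq0// subrK.
have hP := hull_pseudometric e o dP; have hH := hull_hyperbolic o dP hyp.
have hI := hull_isometric_action e o dP iso.
have htri := pseudo_triangle hP.
have [|||p [op psx]] := hull_segment o dP hyp e0
  (a := o) (b := act (s i) o) (u := u) (v := u + C).
- rewrite /u; lra.
- rewrite /u; lra.
- rewrite /u /disp; lra.
have gp g c : orbit_growth_le d act o g c ->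
    orbit_growth_le (@hull_dist _ _ d e) (hull_act iso) p g c.
  move=> [B hB]; apply: (orbit_growth_shift htri hI (x := hull_point dP e0 o)).
  by exists B => n; rewrite (disp_hull_point o).
exists (disp (@hull_dist _ _ d e) (hull_act iso) p), (2 * u).
split=> [g h|j|g]; first exact: dispM htri hI _ _ _.
  suff : disp (@hull_dist _ _ d e) (hull_act iso) p (s j) <= C + 40 * (3 * e).
    lra.
  apply: (disp_le_of_products hP hH hI (x := hull_point dP e0 o)
    (s := s i) (u := u)).
  - lra.
  - lra.
  - exact: op.
  - by rewrite (hull_act_point dP e0 iso).
  - by rewrite (hull_act_point dP e0 iso) (hull_dist_point o); exact: esym uE.
  - by rewrite (disp_hull_point o); apply: le_trans (imax j) _; rewrite -uE.
  - exact: gp.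
  - exact: gp.
  - exact: gp.
rewrite -(disp_hull_point o dP e0 iso).
apply: le_trans (disp_shift htri hI p _ _) _.
rewrite (pseudo_sym hP p); lra.
Qed.

(** * Stable lengths *)

Section StableLength.
Variables (R : realType) (X : Type) (d : X -> X -> R).
Variables (G : groupType) (act : G -> X -> X).
Hypothesis d_ge0 : forall x y, 0 <= d x y.
Hypothesis d_refl : forall x, d x x = 0.
Hypothesis d_tri : forall x y z, d x z <= d x y + d y z.
Hypothesis act_iso : isometric_action d act.

Let act1 : forall x, act 1%g x = x.
Proof. exact: action1 (isometric_is_action act_iso). Qed.

Let u x g n := disp d act x (g ^+ n)%g.
Let u_ge0 x g n : 0 <= u x g n. Proof. exact: d_ge0. Qed.
Let u0 x g : u x g 0 = 0. Proof. by rewrite /u /disp expg0 act1. Qed.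
Let uD x g m n : u x g (m + n) <= u x g m + u x g n.
Proof. by rewrite /u expgnDr; apply: dispM. Qed.

Lemma stable_length_ge0 x g : 0 <= stable_length d act x g.
Proof. exact: (mean_limit_ge0 (u_ge0 x g) (u0 x g) (uD x g)). Qed.

Lemma stable_length_lb x g n :
  stable_length d act x g * n%:R <= disp d act x (g ^+ n)%g.
Proof. exact: (mean_limit_lb (u_ge0 x g) (u0 x g) (uD x g)). Qed.

Lemma orbit_growth_of_stable_length x g c :
  stable_length d act x g < c -> orbit_growth_le d act x g c.
Proof. exact: (growth_of_mean_limit (u_ge0 x g) (u0 x g) (uD x g)). Qed.

Lemma stable_length_of_growth x g c :
  orbit_growth_le d act x g c -> stable_length d act x g <= c.
Proof. exact: (mean_limit_of_growth (u_ge0 x g) (u0 x g) (uD x g)). Qed.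

Lemma stable_length_conj x g h :
  stable_length d act x (g ^ h)%g = stable_length d act x g.
Proof.
apply/eqP; rewrite eq_le; apply/andP; split; apply/ler_addgt0Pr => t t0;
  apply: stable_length_of_growth; apply/(orbit_growth_conj d_tri act_iso x g h);
  by apply: orbit_growth_of_stable_length; rewrite ltrDl.
Qed.

Lemma class_length_conj_class x g :
  class_length d act x (conj_class g) = stable_length d act x g.
Proof.
have [h _] : conj_class g (xget 1%g (conj_class g)).
  by apply: xgetPex; exists (g ^ 1)%g, 1%g.
by rewrite /class_length => <-; exact: stable_length_conj.
Qed.

Lemma stable_length_pow x g n c : orbit_growth_le d act x (g ^+ n)%g c ->
  stable_length d act x g * n%:R <= c.
Proof.
apply: growth_slope_le => k; rewrite -mulrA -natrM -expgnA.
exact: stable_length_lb.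
Qed.

End StableLength.

(** * Words along geodesics *)

Section GeodesicWords.
Variables (R : realType) (X : Type) (d : X -> X -> R).
Variables (G : groupType) (act : G -> X -> X).
Hypothesis d_metric : asymmetric_metric d.
Hypothesis act_iso : isometric_action d act.

(** The word (h i)^-1 (h i.+1), i <= m, spells g.  Each h i x is D-close, in both
    directions, to the i-th point of a subdivision of a geodesic from x to g x
    with mesh r, so a letter costs r + D + D. *)
Lemma geodesic_word D r x g : 0 < r -> 0 <= D -> geodesic d -> cobounded d act D ->
  exists (m : nat) (h : nat -> G),
    [/\ h 0%N = 1%g, h m.+1 = g, m%:R * r <= disp d act x g &
        forall i, (i <= m)%N -> disp d act x ((h i)^-1 * h i.+1)%g <= r + 2 * D].
Proof.
move=> r0 D0 geo cob.
have tri := asym_triangle d_metric; have refl := asym_refl d_metric.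
have [act1 actM] := isometric_is_action act_iso.
have iso := action_isometry act_iso.
have [gam [gam0 gamT gamd]] := geo x (act g x).
set T := d x (act g x) in gamT gamd.
have T0 : 0 <= T by exact: asym_ge0 d_metric _ _.
have Tr0 : 0 <= T / r by rewrite divr_ge0// ltW.
have := truncn_itv Tr0; set m := Num.truncn _ => /andP[mT Tm].
rewrite ler_pdivlMr// in mT; rewrite ltr_pdivrMr// in Tm.
(* The last step may be shorter than r. *)
pose pos (i : nat) := Num.min (i%:R * r) T.
have /choice[c cP] : forall i, exists c,
    Num.max (d (act c x) (gam (pos i))) (d (gam (pos i)) (act c x)) <= D.
  by move=> i; exact: cob.
(* At the endpoints the exact elements 1 and g are available. *)
pose h i := if i == 0%N then 1%g else if i == m.+1 then g else c i.
have near i : d (act (h i) x) (gam (pos i)) <= D /\ d (gam (pos i)) (act (h i) x) <= D.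
  rewrite /h; case: eqP => [->|_].
    by rewrite /pos mul0r min_l// gam0 act1 refl.
  case: eqP => [->|_]; last by apply/andP; rewrite -ge_max.
  by rewrite /pos (min_r (ltW Tm)) gamT refl.
exists m, h; split=> //; first by rewrite /h eqxx.
move=> i im; rewrite /disp actM -(iso (h i)) -actM mulgV act1.
have pos_ge0 : 0 <= pos i by rewrite le_min T0 mulr_ge0// ltW.
have pos_le : pos i <= pos i.+1.
  by rewrite /pos le_min !ge_min lexx orbT andbT ler_wpM2r ?ler_nat ?(ltW r0).
have step : pos i.+1 <= pos i + r.
  have ii : i.+1%:R * r = i%:R * r + r by rewrite -natr1 mulrDl mul1r.
  rewrite /pos ii; case: (leP (i%:R * r) T) => _; first by rewrite ge_min lexx.
  by rewrite ge_min lerDl (ltW r0) orbT.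
have posT : pos i.+1 <= T by rewrite /pos ge_min lexx orbT.
have := gamd _ _ pos_ge0 pos_le posT.
have [? _] := near i; have [_ ?] := near i.+1.
have := tri (act (h i) x) (gam (pos i)) (act (h i.+1) x).
have := tri (gam (pos i)) (gam (pos i.+1)) (act (h i.+1) x).
lra.
Qed.
End GeodesicWords.

(** * Comparison of the two actions *)

Section Comparison.
Variables (R : realType) (G : groupType).
Variables (X : Type) (dX : X -> X -> R) (actX : G -> X -> X) (x0 : X).
Variables (Y : Type) (dY : Y -> Y -> R) (actY : G -> Y -> Y) (y0 : Y).
Variables (delta D L M : R).
Hypothesis dX_metric : asymmetric_metric dX.
Hypothesis actX_iso : isometric_action dX actX.
Hypothesis dY_metric : pseudometric dY.
Hypothesis actY_iso : isometric_action dY actY.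

Let dY_ge0 := pseudometric_ge0 dY_metric.
Let dY_refl := pseudo_refl dY_metric.
Let dY_tri := pseudo_triangle dY_metric.
Let dX_ge0 := asym_ge0 dX_metric.
Let dX_refl := asym_refl dX_metric.
Let dX_tri := asym_triangle dX_metric.

(** The word spelling g^n has d(x0, g^n x0) / r + 1 letters at most, and all its
    letters move one common point of the hull by at most A + 120 delta. *)
Lemma power_displacement (n : nat) (g : G) (A r : R) :
  0 < r -> 0 <= D -> geodesic dX -> cobounded dX actX D ->
  hyperbolic dY delta -> 0 <= delta -> 36 * delta < A ->
  (forall f, disp dX actX x0 f <= r + 2 * D -> stable_length dY actY y0 f < A) ->
  (forall f, disp dX actX x0 f <= 2 * (r + 2 * D) ->
    stable_length dY actY y0 f < 2 * A) ->
  stable_length dY actY y0 g * n%:R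
    <= (disp dX actX x0 (g ^+ n)%g / r + 1) * (A + 120 * delta).
Proof.
move=> r0 D0 geo cob hyp delta0 dA S1 S2.
have [m [h [h0 hg mr steps]]] :=
  geodesic_word dX_metric actX_iso x0 (g ^+ n)%g r0 D0 geo cob.
pose s (i : 'I_m.+1) : G := ((h i)^-1 * h i.+1)%g.
have sle i : disp dX actX x0 (s i) <= r + 2 * D.
  by apply: steps; rewrite -ltnS.
have [nu [B [nuM nus nuB]]] : exists (nu : G -> R) (B : R),
    [/\ forall g h, nu (g * h)%g <= nu g + nu h,
        forall i, nu (s i) <= A + 120 * delta &
        forall g, disp dY actY y0 g <= nu g + B].
  apply: (@joint_displacement _ _ _ _ _ _ _ (ord0 : 'I_m.+1) _ _ _
    dY_metric hyp actY_iso delta0 dA).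
    move=> i; apply: orbit_growth_of_stable_length => //; exact: S1.
  move=> i j; apply: orbit_growth_of_stable_length => //; apply: S2.
  have := dispM dX_tri actX_iso x0 (s i) (s j); have := sle i; have := sle j; lra.
have nuh i : (i <= m)%N -> nu (h i.+1) <= i.+1%:R * (A + 120 * delta).
  elim: i => [|i IH] im.
    by have := nus (Ordinal (im : (0 < m.+1)%N)); rewrite /s /= h0 invg1 mul1g mul1r.
  rewrite -(mulVKg (h i.+1) (h i.+2)); apply: le_trans (nuM _ _) _.
  rewrite -[i.+2%:R]natr1 mulrDl mul1r; apply: lerD; first exact/IH/ltnW.
  exact: (nus (Ordinal (im : (i.+1 < m.+1)%N))).
have nu_pow k f : nu (f ^+ k.+1)%g <= k.+1%:R * nu f.
  elim: k => [|k IH]; first by rewrite expg1 mul1r.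
  rewrite expgS; apply: le_trans (nuM _ _) _.
  by rewrite -[k.+2%:R]natr1 mulrDl mul1r addrC lerD2r.
have le1 : stable_length dY actY y0 g * n%:R <= nu (g ^+ n)%g.
  apply: (stable_length_pow dY_ge0 dY_refl dY_tri actY_iso).
  exists `|B|; case=> [|k].
    by rewrite mulr0 add0r /disp expg0 (action1 (isometric_is_action actY_iso)) dY_refl.
  apply: le_trans (nuB _) _; apply: lerD; last exact: ler_norm.
  by rewrite mulrC nu_pow.
apply: le_trans le1 _; rewrite -hg; apply: le_trans (nuh m (leqnn m)) _.
rewrite -natr1 ler_wpM2r//; first lra.
by rewrite hg lerD2r ler_pdivlMr.
Qed.

(** [power_displacement] for all n, with A = M L / 2 + 36 delta + t; the positive t
    provides the strict inequalities which turn stable lengths into growth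
    bounds. *)
Lemma stable_length_comparison (t : R) (g : G) :
  0 <= D -> 6 * D < L -> 0 <= M -> 0 < t ->
  geodesic dX -> cobounded dX actX D -> hyperbolic dY delta -> 0 <= delta ->
  (forall f, stable_length dX actX x0 f <= L ->
    stable_length dY actY y0 f <= M * stable_length dX actX x0 f) ->
  stable_length dY actY y0 g <=
    (M * (L / 2) + 156 * delta + t) / (L / 2 - 2 * D) * stable_length dX actX x0 g.
Proof.
move=> D0 DL M0 t0 geo cob hyp delta0 short.
set r := L / 2 - 2 * D; have r0 : 0 < r by rewrite /r; lra.
have rD : r + 2 * D = L / 2 by rewrite /r subrK.
set A := M * (L / 2) + 36 * delta + t.
have ML0 : 0 <= M * (L / 2) by apply: mulr_ge0 => //; lra.
have short_disp f b : disp dX actX x0 f <= b -> b <= L ->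
    stable_length dY actY y0 f <= M * b.
  move=> fb bL.
  have lf : stable_length dX actX x0 f <= b.
    have := stable_length_lb dX_ge0 dX_refl dX_tri actX_iso x0 f 1.
    by rewrite mulr1 expg1 => /le_trans; apply.
  by apply: le_trans (short f (le_trans lf bL)) _; rewrite ler_wpM2l.
have main n := @power_displacement n g A r r0 D0 geo cob hyp delta0.
set Q := (A + 120 * delta) / r.
have -> : M * (L / 2) + 156 * delta + t = A + 120 * delta by rewrite /A; lra.
have Q0 : 0 <= Q by rewrite /Q divr_ge0 ?(ltW r0)// /A; lra.
apply/ler_addgt0Pr => z z0.
(* The stable length on X is only approached by growth rates from above; the
   slack is chosen so that it costs at most z in the end. *)
have z' : 0 < z / (Q + 1) by rewrite divr_gt0//; lra.
have [B hB] : orbit_growth_le dX actX x0 g (stable_length dX actX x0 g + z / (Q + 1)).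
  by apply: orbit_growth_of_stable_length => //; rewrite ltrDl.
have zQ : Q * (z / (Q + 1)) <= z.
  rewrite mulrCA ler_piMr ?(ltW z0)// ler_pdivrMr; lra.
apply: (@slope_le _ _ _ (Q * B + (A + 120 * delta))) => n.
apply: le_trans (main n _ _ _) _.
- by rewrite /A; lra.
- move=> f; rewrite rD => fb; have := short_disp f (L / 2) fb.
  by rewrite /A; lra.
- move=> f; rewrite rD => fb; have := short_disp f L.
  by rewrite /A; lra.
have -> : (disp dX actX x0 (g ^+ n)%g / r + 1) * (A + 120 * delta) =
    Q * disp dX actX x0 (g ^+ n)%g + (A + 120 * delta).
  by rewrite mulrDl mul1r mulrAC -mulrA mulrC.
rewrite [leRHS]addrA lerD2r.
apply: le_trans (ler_wpM2l Q0 (hB n)) _.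
rewrite mulrDr lerD2r mulrA ler_wpM2r// mulrDr lerD2l.
exact: zQ.
Qed.
End Comparison.

(** * The bound on the dilation *)

Lemma length_le_of_ratio_le (R : realType) (G : groupType)
    (lstar l : set G -> R) (L M : R) :
  null_classes_null lstar l -> (forall c, 0 <= l c) ->
  (forall c, conj_classes c -> 0 < l c -> l c <= L -> lstar c / l c <= M) ->
  forall c, conj_classes c -> l c <= L -> lstar c <= M * l c.
Proof.
move=> nul l0 ratio c cc cL.
have := l0 c; rewrite le_eqVlt => /predU1P[/esym c0|c0].
  by rewrite nul// c0 mulr0.
by rewrite -ler_pdivrMr//; exact: ratio.
Qed.

Theorem theorem1p2 (R : realType) :
  exists K : R, 0 < K /\
  forall (G : groupType)
         (X : Type) (dX : X -> X -> R) (actX : G -> X -> X) (x0 : X)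
         (Xs : metricType R) (actXs : G -> Xs -> Xs) (y0 : Xs)
         (delta D L : R),
    let lX := class_length dX actX x0 in
    let lXs := class_length (@mdist R Xs) actXs y0 in
    0 <= delta -> 0 <= D ->
    isometric_action dX actX ->
    isometric_action (@mdist R Xs) actXs ->
    hyperbolic (@mdist R Xs) delta ->
    non_elementary (@mdist R Xs) actXs ->
    asymmetric_metric dX ->
    geodesic dX ->
    cobounded dX actX D ->
    null_classes_null lXs lX ->
    6 * D < L ->
    (dilation lXs lX <=
       sup_length_ratio lXs lX L * ((L - 2 * D) / (L - 6 * D))%:E
       + (2 * K * delta / (L - 6 * D))%:E)%E.
Proof.
exists 156; split; first by rewrite ltr0n.
move=> G X dX actX x0 Xs actXs y0 delta D L lX lXs delta0 D0 isoX isoXs hyp _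
  dX_metric geo cob nul DL.
have dXs_metric : pseudometric (@mdist R Xs).
  by split; [exact: mdistxx|exact: metric_sym|exact: metric_triangle].
have dX_ge0 := asym_ge0 dX_metric; have dX_refl := asym_refl dX_metric.
have dX_tri := asym_triangle dX_metric.
have dXs_ge0 := pseudometric_ge0 dXs_metric.
have dXs_refl := pseudo_refl dXs_metric.
have dXs_tri := pseudo_triangle dXs_metric.
have lX_ge0 c : 0 <= lX c by apply: stable_length_ge0.
have lXE g : lX (conj_class g) = stable_length dX actX x0 g.
  exact: class_length_conj_class.
have lXsE g : lXs (conj_class g) = stable_length (@mdist R Xs) actXs y0 g.
  exact: class_length_conj_class.
have den : 0 < L - 6 * D by rewrite subr_gt0.
have num : 0 < L - 2 * D by lra.
have a0 : 0 < (L - 2 * D) / (L - 6 * D) by exact: divr_gt0.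
have S0 : (0 <= sup_length_ratio lXs lX L)%E by rewrite /sup_length_ratio le_max lexx.
have Sub c : conj_classes c -> 0 < lX c -> lX c <= L ->
    ((lXs c / lX c)%:E <= sup_length_ratio lXs lX L)%E.
  move=> cc c0 cL; rewrite /sup_length_ratio le_max; apply/orP; right.
  by apply: ereal_sup_ubound; exists c.
move: (sup_length_ratio _ _ _) S0 Sub => [M||] //.
- rewrite lee_fin => M0 Sub.
  have short := length_le_of_ratio_le nul lX_ge0 Sub.
  rewrite -EFinM -EFinD; apply/lee_addgt0Pr => t t0; rewrite -EFinD.
  set eta := (X in X%:E).
  apply: ge_ereal_inf; exists eta%:E => //; exists eta => //.
  set r := L / 2 - 2 * D; have r0 : 0 < r by rewrite /r; lra.
  (* L - 6 D <= L - 4 D = 2 r, and L (L - 6 D) <= (L - 2 D) (L - 4 D). *)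
  have bound : (M * (L / 2) + 156 * delta + t * r) / r <= eta.
    rewrite /eta ler_pdivrMr//.
    have bM : M * (L / 2) <= M * ((L - 2 * D) / (L - 6 * D)) * r.
      rewrite -mulrA ler_wpM2l// mulrAC ler_pdivlMr// /r; nra.
    have bd : 156 * delta <= 2 * 156 * delta / (L - 6 * D) * r.
      rewrite mulrAC ler_pdivlMr// /r; nra.
    by rewrite [leRHS]mulrDl lerD2r [leRHS]mulrDl; exact: lerD.
  split.
    apply: ltr_wpDl => //; apply: addr_ge0.
      by apply: mulr_ge0 => //; exact: ltW.
    by apply: divr_ge0; [rewrite mulr_ge0 ?mulr_ge0|exact: ltW].
  move=> _ [g _ <-]; rewrite lXsE.
  apply: le_trans _ (ler_wpM2r (lX_ge0 _) bound); rewrite lXE.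
  have tr0 : 0 < t * r by rewrite mulr_gt0.
  have short_gp f : stable_length dX actX x0 f <= L ->
      stable_length (@mdist R Xs) actXs y0 f <= M * stable_length dX actX x0 f.
    by move=> fL; rewrite -lXE -lXsE; apply: short; rewrite ?lXE//; exists f.
  have := stable_length_comparison dX_metric isoX dXs_metric isoXs g D0 DL M0
    tr0 geo cob hyp delta0 short_gp.
  by [].
- by move=> _ _; rewrite gt0_mulye// addye// leey.
Qed.
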